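(* Let $\Phi_{\mathbb{O}}:\mathbb{O}^2\to\mathcal{H}_2^0(\mathbb{O})$ be the octonionic Hopf map. Then: (1) $\Phi_{\mathbb{O}}$ is surjective. (2) For each $(\lambda,\alpha)\in\mathbb{R}\oplus\mathbb{O}$: if $(\lambda,\alpha)\neq(0,0)$ then $$\Phi_{\mathbb{O}}^{-1}\left(\begin{pmatrix}\lambda&\alpha\\ \overline{\alpha}&-\lambda\end{pmatrix}\right)\simeq\mathbb{O}(1)\quad\text{(homeomorphic)},$$ and if $(\lambda,\alpha)=(0,0)$ then $$\Phi_{\mathbb{O}}^{-1}\left(\begin{pmatrix}0&0\\ 0&0\end{pmatrix}\right)=\left\{\begin{pmatrix}0\\ 0\end{pmatrix}\right\}.$$
   Context: $\mathbb{O}$ is the normed division algebra of octonions. $\mathcal{H}_2^0(\mathbb{O})$ is the real vector space of $2\times2$ traceless Hermitian matrices over $\mathbb{O}$. The octonionic Hopf map is $\Phi_{\mathbb{O}}(v)=vv^*-\frac{\mathrm{tr}(vv^* )}{2}I_2$ for a column vector $v\in\mathbb{O}^2$, i.e. $$\Phi_{\mathbb{O}}\begin{pmatrix}x\\ y\end{pmatrix}=\begin{pmatrix}\frac{|x|^2-|y|^2}{2}&x\bar{y}\\ y\bar{x}&\frac{|y|^2-|x|^2}{2}\end{pmatrix}.$$ $\mathbb{O}(1)=\{c\in\mathbb{O}:|c|=1\}=S^7$. *)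

(* Defs.v *)
From HB Require Import structures.
From mathcomp Require Import all_boot all_order all_algebra.
From mathcomp Require Import all_classical all_reals all_analysis.
From mathcomp Require Import ring.

Set Implicit Arguments.
Unset Strict Implicit.
Unset Printing Implicit Defensive.

Import Order.TTheory GRing.Theory Num.Theory.
Import numFieldNormedType.Exports.

Local Open Scope classical_set_scope.
Local Open Scope ring_scope.

Section CayleyDickson.
Variables (V : zmodType) (mul : V -> V -> V) (conj : V -> V).

(* (a, b) (c, d) = (a c - d^* b, d a + b c^* ), with (a, b)^* = (a^*, - b) *)
Definition cd_mul (p q : V * V) : V * V :=
  (mul p.1 q.1 - mul (conj q.2) p.2, mul q.2 p.1 + mul p.2 (conj q.1)).

Definition cd_conj (p : V * V) : V * V := (conj p.1, - p.2).

End CayleyDickson.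

Definition cd_sqnorm (R : nmodType) (V : Type) (N : V -> R) (p : V * V) : R :=
  N p.1 + N p.2.

(* The third Cayley-Dickson double of the reals, as a real vector space with
   the product topology. The product and the norm are [omul] and [onorm] below;
   since the type unfolds to iterated pairs, [x * y] and [`|x|] would denote
   the componentwise product and the sup norm, which are not used. *)
Definition octonion (R : realType) : Type :=
  (((R^o * R^o) * (R^o * R^o)) * ((R^o * R^o) * (R^o * R^o)))%type.

HB.instance Definition _ (R : realType) := GRing.Lmodule.on (octonion R).
HB.instance Definition _ (R : realType) := Topological.on (octonion R).

Variant ord2_spec : 'I_2 -> Prop :=
  | Ord2_0 : ord2_spec 0
  | Ord2_1 : ord2_spec 1.

Lemma ord2P i : ord2_spec i.
Proof.
case: i => [[|[|//]]] lt_i2; rewrite (bool_irrelevance lt_i2 isT).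
- by rewrite (_ : Ordinal _ = 0); [constructor | apply/val_inj].
- by rewrite (_ : Ordinal _ = 1); [constructor | apply/val_inj].
Qed.

Lemma pairD (U V : nmodType) (a c : U) (b d : V) :
  (a, b) + (c, d) = (a + c, b + d).
Proof. by []. Qed.

Lemma pairN (U V : zmodType) (a : U) (b : V) : - (a, b) = (- a, - b).
Proof. by []. Qed.

Section Octonions.
Variable R : realType.
Implicit Types x y : octonion R.

Definition omul : octonion R -> octonion R -> octonion R :=
  let Cmul := cd_mul (fun a b : R^o => a * b) id in
  let Cconj := cd_conj (V := R^o) id in
  let Hmul := cd_mul Cmul Cconj in
  let Hconj := cd_conj Cconj in
  cd_mul Hmul Hconj.

Definition oconj : octonion R -> octonion R :=
  cd_conj (cd_conj (cd_conj (V := R^o) id)).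

Definition osqnorm : octonion R -> R :=
  cd_sqnorm (cd_sqnorm (cd_sqnorm (fun a : R => a ^+ 2))).

Definition onorm x : R := Num.sqrt (osqnorm x).

Definition oreal (r : R) : octonion R :=
  (((r, 0), (0, 0)), ((0, 0), (0, 0))).

Ltac octonion_ring :=
  rewrite /omul /oconj /osqnorm /oreal /cd_mul /cd_conj /cd_sqnorm /=
    ?(pairN, pairD) /=;
  congr (_, _, (_, _), (_, _, (_, _))); ring.

Lemma orealD r s : oreal (r + s) = oreal r + oreal s.
Proof. by rewrite /oreal !pairD !addr0. Qed.

Lemma orealN r : oreal (- r) = - oreal r.
Proof. by rewrite /oreal !pairN !oppr0. Qed.

Lemma orealZ r s : oreal (r * s) = r *: oreal s.
Proof.
have pairZ (U V : lmodType R) (k : R) (a : U) (b : V) :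
  k *: (a, b) = (k *: a, k *: b) by [].
by rewrite /oreal !pairZ !scaler0.
Qed.

Lemma oconj_real r : oconj (oreal r) = oreal r.
Proof. by rewrite /oreal /oconj /cd_conj /= !oppr0. Qed.

Lemma osqnorm_ge0 x : 0 <= osqnorm x.
Proof. by rewrite /osqnorm /cd_sqnorm !addr_ge0 ?sqr_ge0. Qed.

Lemma sqr_onorm x : onorm x ^+ 2 = osqnorm x.
Proof. by rewrite sqr_sqrtr ?osqnorm_ge0. Qed.

Lemma onorm_eq0 x : onorm x = 0 <-> x = 0.
Proof.
split; last first.
  by move=> ->; rewrite /onorm /osqnorm /cd_sqnorm /= expr0n !addr0 sqrtr0.
move=> x0; have := sqr_onorm x; rewrite x0 expr0n /= => /esym/eqP.
case: x {x0} => [[[a b] [c d]] [[e f] [g h]]]; rewrite /osqnorm /cd_sqnorm /=.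
rewrite !paddr_eq0 ?addr_ge0 ?sqr_ge0 // !sqrf_eq0.
by do !case/andP; do !move=> /andP[] || move=> /eqP ->.
Qed.

Lemma oconjK : involutive oconj.
Proof.
by move=> [[[a b] [c d]] [[e f] [g h]]]; rewrite /oconj /cd_conj /= !opprK.
Qed.

Lemma onorm_conj x : onorm (oconj x) = onorm x.
Proof.
case: x => [[[a b] [c d]] [[e f] [g h]]].
by rewrite /onorm /osqnorm /cd_sqnorm /oconj /cd_conj /= !sqrrN.
Qed.

Lemma omul1x x : omul (oreal 1) x = x.
Proof.
case: x => [[[a b] [c d]] [[e f] [g h]]].
octonion_ring.
Qed.

Lemma omulx1 x : omul x (oreal 1) = x.
Proof.
case: x => [[[a b] [c d]] [[e f] [g h]]].
octonion_ring.
Qed.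

Lemma oconjM x y : oconj (omul x y) = omul (oconj y) (oconj x).
Proof.
case: x => [[[a b] [c d]] [[e f] [g h]]].
case: y => [[[a' b'] [c' d']] [[e' f'] [g' h']]].
octonion_ring.
Qed.

Lemma omul_conj x : omul x (oconj x) = oreal (onorm x ^+ 2).
Proof.
rewrite sqr_onorm; case: x => [[[a b] [c d]] [[e f] [g h]]].
octonion_ring.
Qed.

Lemma onormM x y : onorm (omul x y) = onorm x * onorm y.
Proof.
rewrite /onorm -sqrtrM ?osqnorm_ge0//; congr Num.sqrt.
case: x => [[[a b] [c d]] [[e f] [g h]]].
case: y => [[[a' b'] [c' d']] [[e' f'] [g' h']]].
by rewrite /osqnorm /omul /cd_mul /cd_conj /cd_sqnorm /=
  ?(pairN, pairD) /=; ring.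
Qed.

Definition unit_octonions : set (octonion R) := [set c | onorm c = 1].

Definition hermitian_octonion_mx n (A : 'M[octonion R]_n) : Prop :=
  map_mx oconj A^T = A.

Definition traceless_hermitian : set 'M[octonion R]_2 :=
  [set A | hermitian_octonion_mx A /\ \tr A = 0].

(* The library's [*m] needs an associative product, hence the explicit entries
   of v v^* *)
Definition ocol_sqr (v : 'cV[octonion R]_2) : 'M[octonion R]_2 :=
  \matrix_(i, j) omul (v i 0) (oconj (v j 0)).

Definition hopf_mx (v : 'cV[octonion R]_2) : 'M[octonion R]_2 :=
  ocol_sqr v - (2^-1 *: \tr (ocol_sqr v))%:M.

Definition col2 x y : 'cV[octonion R]_2 := \col_i if i == 0 then x else y.

Definition mx22 (a b c d : octonion R) : 'M[octonion R]_2 :=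
  \matrix_(i, j) if i == 0 then (if j == 0 then a else b)
                 else (if j == 0 then c else d).

Lemma mx22P (A : 'M[octonion R]_2) : A = mx22 (A 0 0) (A 0 1) (A 1 0) (A 1 1).
Proof.
by apply/matrixP => i j; rewrite mxE; case/ord2P: i; case/ord2P: j.
Qed.

Lemma col2P (v : 'cV[octonion R]_2) : v = col2 (v 0 0) (v 1 0).
Proof.
by apply/matrixP => i j; rewrite mxE ord1; case/ord2P: i.
Qed.

Lemma mx22_traceless_hermitian lambda alpha :
  traceless_hermitian
    (mx22 (oreal lambda) alpha (oconj alpha) (- oreal lambda)).
Proof.
split; last by rewrite /mxtrace big_ord_recl big_ord1 !mxE /= subrr.
rewrite /hermitian_octonion_mx [LHS]mx22P !mxE /= oconjK.
by rewrite -orealN !oconj_real.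
Qed.

Lemma hopf_col2 x y :
  hopf_mx (col2 x y) =
  mx22 (oreal ((onorm x ^+ 2 - onorm y ^+ 2) / 2)) (omul x (oconj y))
       (omul y (oconj x)) (oreal ((onorm y ^+ 2 - onorm x ^+ 2) / 2)).
Proof.
have tr : \tr (ocol_sqr (col2 x y)) = oreal (onorm x ^+ 2 + onorm y ^+ 2).
  by rewrite /mxtrace big_ord_recl big_ord1 !mxE /= !omul_conj -orealD.
rewrite [LHS]mx22P !mxE /= tr !mulr0n !mulr1n !subr0 !omul_conj.
rewrite -orealZ -!orealN -!orealD.
by congr (mx22 (oreal _) _ _ (oreal _)); field.
Qed.

Lemma hopf_mx_traceless_hermitian v : traceless_hermitian (hopf_mx v).
Proof.
rewrite (col2P v) hopf_col2.
set x := v 0 0; set y := v 1 0.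
have -> : omul y (oconj x) = oconj (omul x (oconj y)).
  by rewrite oconjM oconjK.
rewrite -[onorm y ^+ 2 - _]opprB mulNr orealN.
exact: mx22_traceless_hermitian.
Qed.

Definition hopf (v : 'cV[octonion R]_2) : traceless_hermitian :=
  exist _ (hopf_mx v) (mem_set (hopf_mx_traceless_hermitian v)).

Definition traceless_hermitian_mx (lambda : R) (alpha : octonion R) :
    traceless_hermitian :=
  exist _ (mx22 (oreal lambda) alpha (oconj alpha) (- oreal lambda))
    (mem_set (mx22_traceless_hermitian lambda alpha)).

End Octonions.

Arguments unit_octonions R : clear implicits.
Arguments traceless_hermitian R : clear implicits.

Definition homeomorphic (S T : topologicalType) : Prop :=
  exists (f : S -> T) (g : T -> S),
    [/\ cancel f g, cancel g f, continuous f & continuous g].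

(* Main.v *)
(* If [v = (x, y)] lies over [(lambda, alpha)], then [|x|^2 + |y|^2 = 2 r] with
   [r^2 = lambda^2 + |alpha|^2], so [|x|] and [|y|] are constant on the fiber.
   When [x] does not vanish, alternativity solves [x y^* = alpha] as
   [y = alpha^* x / |x|^2], so [v |-> x / |x|] is a homeomorphism onto the unit
   octonions. Exchanging [x] and [y] maps the fiber over [(lambda, alpha)] to
   the one over [(- lambda, alpha^* )], which reduces to [lambda >= 0], where
   [|x|^2 = lambda + r > 0] away from the origin. *)

Require Import Defs.
From mathcomp Require Import all_boot all_order all_algebra.
From mathcomp Require Import all_classical all_reals all_analysis.
From mathcomp Require Import ring lra.

Import Order.TTheory GRing.Theory Num.Theory.
Import numFieldNormedType.Exports.

Local Open Scope classical_set_scope.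
Local Open Scope ring_scope.

(** * Homeomorphisms between subspaces *)

Lemma homeomorphic_trans (S T U : topologicalType) :
  homeomorphic S T -> homeomorphic T U -> homeomorphic S U.
Proof.
move=> [f [g [fK gK fc gc]]] [f' [g' [fK' gK' fc' gc']]].
exists (f' \o f), (g \o g'); split.
- exact: can_comp fK' fK.
- exact: can_comp gK gK'.
- by move=> x; apply: continuous_comp; [exact: fc | exact: fc'].
- by move=> x; apply: continuous_comp; [exact: gc' | exact: gc].
Qed.

(** The maps are continuous on the whole spaces but mutually inverse only between [A] and [B]. Their
    restrictions are continuous because a subspace carries the initial topology of its inclusion. *)
Lemma homeomorphic_sets (S T : topologicalType) (A : set S) (B : set T)
    (f : S -> T) (g : T -> S) :
  continuous f -> continuous g ->
  (forall x, A x -> B (f x)) -> (forall y, B y -> A (g y)) ->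
  (forall x, A x -> g (f x) = x) -> (forall y, B y -> f (g y) = y) ->
  homeomorphic A B.
Proof.
move=> fc gc fAB gBA gfK fgK.
pose F (a : A) : B := exist _ (f (val a)) (mem_set (fAB _ (set_mem (valP a)))).
pose G (b : B) : A := exist _ (g (val b)) (mem_set (gBA _ (set_mem (valP b)))).
exists F, G; split.
- by move=> a; apply: val_inj; apply: gfK; exact: set_mem (valP a).
- by move=> b; apply: val_inj; apply: fgK; exact: set_mem (valP b).
- apply: continuous_comp_initial => a.
  apply: (@continuous_comp _ _ _ (set_val : A -> S) f); last exact: fc.
  exact: initial_continuous.
- apply: continuous_comp_initial => b.
  apply: (@continuous_comp _ _ _ (set_val : B -> T) g); last exact: gc.
  exact: initial_continuous.
Qed.

(** * Continuity for matrices and for the octonion operations *)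

Lemma mx_entry_continuous (T : topologicalType) m n (i : 'I_m) (j : 'I_n) :
  continuous (fun M : 'M[T]_(m, n) => M i j).
Proof.
move=> M A MA; exists (fun k l => if (k == i) && (l == j) then A else setT).
  by move=> k l; case: ifP => [/andP[/eqP-> /eqP->] //|_]; exact: filterT.
by move=> N /(_ i j); rewrite !eqxx.
Qed.

(** A neighborhood of a matrix contains a product of neighborhoods of its finitely many entries. *)
Lemma mx_continuous (S T : topologicalType) m n (f : S -> 'M[T]_(m, n)) :
  (forall i j, continuous (fun x => f x i j)) -> continuous f.
Proof.
move=> fc x A [P Pf PA].
have H : \forall y \near x, forall ij, P ij.1 ij.2 (f y ij.1 ij.2).
  by apply: filter_forall => -[i j] /=; apply: fc; exact: Pf.
by apply: filterS H => y H; apply: PA => i j; exact: (H (i, j)).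
Qed.

(** One doubling step; three of them lead from real multiplication to the octonion product. *)
Lemma cd_mul_continuous (R : realType) (V : normedModType R)
    (mul : V -> V -> V) (conj : V -> V) :
  continuous (fun p : V * V => mul p.1 p.2) -> continuous conj ->
  continuous (fun p : (V * V) * (V * V) => cd_mul mul conj p.1 p.2).
Proof.
move=> mulc conjc p.
have mulP (g h : (V * V) * (V * V) -> V) : {for p, continuous g} ->
    {for p, continuous h} -> {for p, continuous (fun q => mul (g q) (h q))}.
  move=> gc hc; apply: (@continuous_comp _ _ _ (fun q => (g q, h q))
      (fun r => mul r.1 r.2)).
    exact: cvg_pair gc hc.
  exact: mulc.
have conjP (g : (V * V) * (V * V) -> V) : {for p, continuous g} ->
    {for p, continuous (fun q => conj (g q))}.
  by move=> gc; apply: (@continuous_comp _ _ _ g conj); [| exact: conjc].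
have c11 : {for p, continuous (fun q : (V * V) * (V * V) => q.1.1)}.
  by apply: continuous_comp; exact: cvg_fst.
have c12 : {for p, continuous (fun q : (V * V) * (V * V) => q.1.2)}.
  by apply: continuous_comp; [exact: cvg_fst | exact: cvg_snd].
have c21 : {for p, continuous (fun q : (V * V) * (V * V) => q.2.1)}.
  by apply: continuous_comp; [exact: cvg_snd | exact: cvg_fst].
have c22 : {for p, continuous (fun q : (V * V) * (V * V) => q.2.2)}.
  by apply: continuous_comp; exact: cvg_snd.
apply: cvg_pair.
- by apply: cvgB; apply: mulP => //; exact: conjP.
- by apply: cvgD; apply: mulP => //; exact: conjP.
Qed.

Lemma cd_conj_continuous (R : realType) (V : normedModType R) (conj : V -> V) :
  continuous conj -> continuous (cd_conj conj).
Proof.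
move=> conjc p; apply: cvg_pair.
- by apply: (@continuous_comp _ _ _ fst conj); [exact: cvg_fst | exact: conjc].
- by apply: cvgN; exact: cvg_snd.
Qed.

Lemma continuous_pair_fixed (S T U : topologicalType) (f : S * T -> U) (a : S) :
  continuous f -> continuous (fun y => f (a, y)).
Proof.
move=> fc y; apply: (@continuous_comp _ _ _ (fun y => (a, y)) f).
  by apply: cvg_pair; [exact: cvg_cst | exact: cvg_id].
exact: fc.
Qed.

Section OctonionContinuity.
Variable R : realType.

Lemma omul_continuous (a : octonion R) : continuous (omul a).
Proof.
have c1 : continuous (@id R^o) by move=> x; exact: cvg_id.
have c2 := cd_conj_continuous R R^o _ c1.
have c3 := cd_conj_continuous R (R^o * R^o)%type _ c2.
have m1 : continuous (fun p : R^o * R^o => p.1 * p.2 : R^o).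
  by move=> p; apply: cvgM; [exact: cvg_fst | exact: cvg_snd].
have m2 := cd_mul_continuous R R^o _ _ m1 c1.
have m3 := cd_mul_continuous R (R^o * R^o)%type _ _ m2 c2.
have m4 := cd_mul_continuous R ((R^o * R^o) * (R^o * R^o))%type _ _ m3 c3.
exact: (continuous_pair_fixed _ _ _ (fun p => omul p.1 p.2) a m4).
Qed.

Lemma octonion_scale_continuous (k : R) :
  continuous (fun x : octonion R => k *: x).
Proof.
exact: (@scaler_continuous _
  (((R^o * R^o) * (R^o * R^o)) * ((R^o * R^o) * (R^o * R^o)))%type k).
Qed.

Lemma col2_continuous (S : topologicalType) (f g : S -> octonion R) :
  continuous f -> continuous g -> continuous (fun s => col2 (f s) (g s)).
Proof.
move=> fc gc; apply: mx_continuous => i j.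
have -> : (fun s => col2 (f s) (g s) i j) = if i == 0 then f else g.
  by apply/funext => s; rewrite mxE; case: ifP.
by case: ifP.
Qed.

End OctonionContinuity.

(** * Octonion identities that replace associativity *)

Section OctonionAlgebra.
Variable R : realType.
Implicit Types (x y : octonion R) (k : R).

Let pairZ (U V : lmodType R) k (a : U) (b : V) :
  k *: (a, b) = (k *: a, k *: b).
Proof. by []. Qed.

Let scaleRE k (a : R^o) : k *: a = k * a.
Proof. by []. Qed.

Ltac octonion_unfold :=
  rewrite /omul /oconj /osqnorm /cd_mul /cd_conj /cd_sqnorm /=
    ?(pairN, pairD, pairZ) /= ?scaleRE.

Ltac octonion_ring :=
  octonion_unfold; congr (_, _, (_, _), (_, _, (_, _))); ring.

Lemma omulZl k x y : omul (k *: x) y = k *: omul x y.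
Proof.
case: x => [[[a b] [c d]] [[e f] [g h]]].
case: y => [[[a' b'] [c' d']] [[e' f'] [g' h']]].
octonion_ring.
Qed.

Lemma omulZr k x y : omul x (k *: y) = k *: omul x y.
Proof.
case: x => [[[a b] [c d]] [[e f] [g h]]].
case: y => [[[a' b'] [c' d']] [[e' f'] [g' h']]].
octonion_ring.
Qed.

Lemma oconjZ k x : oconj (k *: x) = k *: oconj x.
Proof.
case: x => [[[a b] [c d]] [[e f] [g h]]].
octonion_ring.
Qed.

Lemma osqnormZ k x : osqnorm (k *: x) = k ^+ 2 * osqnorm x.
Proof.
case: x => [[[a b] [c d]] [[e f] [g h]]].
by rewrite /osqnorm /cd_sqnorm !pairZ /= !scaleRE; ring.
Qed.

(** A form of left alternativity, because x + x^* is real. *)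
Lemma omul_mul_conj x y : omul x (omul (oconj x) y) = osqnorm x *: y.
Proof.
(* Naming the coordinates of the inner product keeps the terms small while the
   definitions are unfolded. *)
case zE: (omul (oconj x) y) => [[[z1 z2] [z3 z4]] [[z5 z6] [z7 z8]]].
case: x zE => [[[a b] [c d]] [[e f] [g h]]].
case: y => [[[a' b'] [c' d']] [[e' f'] [g' h']]].
octonion_unfold => -[<- <- <- <- <- <- <- <-].
congr (_, _, (_, _), (_, _, (_, _))); ring.
Qed.

Lemma osqnorm_conj x : osqnorm (oconj x) = osqnorm x.
Proof. by rewrite -!sqr_onorm onorm_conj. Qed.

Lemma osqnormM x y : osqnorm (omul x y) = osqnorm x * osqnorm y.
Proof. by rewrite -!sqr_onorm onormM exprMn. Qed.

Lemma osqnorm_eq0 x : osqnorm x = 0 -> x = 0.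
Proof. by move=> x0; apply/onorm_eq0; rewrite /onorm x0 sqrtr0. Qed.

(** Conjugation reverses products, so this is the mirror image of [omul_mul_conj], taken at the
    conjugates of [x] and [y]. *)
Lemma omul_conj_mul x y : omul (omul y (oconj x)) x = osqnorm x *: y.
Proof.
apply: (can_inj (@oconjK R)).
rewrite !oconjM oconjK oconjZ -[in RHS]osqnorm_conj -omul_mul_conj.
by rewrite oconjK.
Qed.

End OctonionAlgebra.

(** * Fibers of the Hopf map *)

Section Fibers.
Variable R : realType.
Implicit Types (x y alpha : octonion R) (lambda : R).

(** Both matrices are Hermitian and traceless, so their first rows determine them. *)
Lemma hopf_fiberP lambda alpha (v : 'cV[octonion R]_2) :
  hopf v = traceless_hermitian_mx lambda alpha <->
  osqnorm (v 0 0) - osqnorm (v 1 0) = 2 * lambda /\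
  omul (v 0 0) (oconj (v 1 0)) = alpha.
Proof.
set x := v 0 0; set y := v 1 0.
have vE : hopf_mx v = mx22 (oreal ((osqnorm x - osqnorm y) / 2))
    (omul x (oconj y)) (oconj (omul x (oconj y)))
    (- oreal ((osqnorm x - osqnorm y) / 2)).
  rewrite (col2P v) hopf_col2 -/x -/y !sqr_onorm oconjM oconjK -orealN.
  by rewrite -[osqnorm y - _]opprB mulNr.
split=> [/(congr1 val)|[lambdaE alphaE]]; last first.
  apply: val_inj; rewrite /= vE alphaE lambdaE.
  by have -> : 2 * lambda / 2 = lambda by field.
rewrite /= vE => /matrixP vA; have := vA 0 0; have := vA 0 1.
(* The coordinate [z.1.1.1] is the real part, which recovers [lambda] from [oreal lambda]. *)
rewrite !mxE /= => -> /(congr1 (fun z : octonion R => z.1.1.1)) /= <-.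
by split=> //; field.
Qed.

(** Swapping the coordinates negates |x|^2 - |y|^2 and conjugates x y^*; the swap is its own
    inverse. *)
Lemma hopf_fiber_swap lambda alpha :
  homeomorphic [set v | hopf v = traceless_hermitian_mx lambda alpha]
    [set v | hopf v = traceless_hermitian_mx (- lambda) (oconj alpha)].
Proof.
pose swap (v : 'cV[octonion R]_2) := col2 (v 1 0) (v 0 0).
have swapc : continuous swap.
  by apply: col2_continuous; exact: mx_entry_continuous.
have swapK v : swap (swap v) = v.
  by rewrite [RHS]col2P /swap !mxE.
have swapF l a v : hopf v = traceless_hermitian_mx l a ->
    hopf (swap v) = traceless_hermitian_mx (- l) (oconj a).
  move=> /hopf_fiberP[lE <-]; apply/hopf_fiberP; rewrite !mxE /=.
  by rewrite mulrN -lE opprB oconjM oconjK.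
apply: (homeomorphic_sets _ _ _ _ swap swap) => // v /=.
- exact: swapF.
- by move=> /swapF; rewrite opprK oconjK.
Qed.

(** On this fiber |x| is the positive constant [s], so dividing by |x| is scaling by a fixed real,
    and both maps extend continuously to the whole spaces. *)
Lemma hopf_fiber_homeo_ge0 lambda alpha :
  0 <= lambda -> (lambda, alpha) <> (0, 0) ->
  homeomorphic [set v | hopf v = traceless_hermitian_mx lambda alpha]
    (unit_octonions R).
Proof.
move=> lambda_ge0 nz.
have alpha_ge0 := osqnorm_ge0 alpha.
set r := Num.sqrt (lambda ^+ 2 + osqnorm alpha).
have r_ge0 : 0 <= r by exact: sqrtr_ge0.
have r2 : r ^+ 2 = lambda ^+ 2 + osqnorm alpha.
  by rewrite sqr_sqrtr // addr_ge0 // sqr_ge0.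
(* If the sum vanished, so would both nonnegative terms, and then [alpha] too, against [nz]. *)
have p_gt0 : 0 < lambda + r.
  rewrite lt_neqAle addr_ge0 // andbT eq_sym paddr_eq0 //.
  apply/negP => /andP[/eqP lambda0 /eqP r0]; apply: nz.
  move: r2; rewrite lambda0 r0 expr0n add0r => /esym/osqnorm_eq0 ->.
  by [].
set s := Num.sqrt (lambda + r).
have s_gt0 : 0 < s by rewrite sqrtr_gt0.
have s_neq0 : s != 0 by rewrite gt_eqF.
have s2 : s ^+ 2 = lambda + r by rewrite sqr_sqrtr // ltW.
(* This is (r + lambda) (r - lambda); the second factor will be |y|^2. *)
have alphaE : osqnorm alpha = s ^+ 2 * (s ^+ 2 - 2 * lambda).
  by rewrite s2; ring: r2.
have normE v : hopf v = traceless_hermitian_mx lambda alpha ->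
    osqnorm (v 0 0) = s ^+ 2.
  move=> /hopf_fiberP[].
  set x := v 0 0; set y := v 1 0 => lE /(congr1 (@osqnorm R)).
  rewrite osqnormM osqnorm_conj => aE.
  have x_ge0 := osqnorm_ge0 x; have y_ge0 := osqnorm_ge0 y.
  (* The left side is (|x|^2 - |y|^2)^2 + 4 |x|^2 |y|^2, and the fiber equations give both terms. *)
  have : (osqnorm x + osqnorm y) ^+ 2 = (2 * r) ^+ 2.
    rewrite exprMn r2 -aE.
    have -> : lambda = (osqnorm x - osqnorm y) / 2 by rewrite lE; field.
    by field.
  have sum_ge0 : 0 <= osqnorm x + osqnorm y by lra.
  have r2_ge0 : 0 <= 2 * r by lra.
  by move=> /eqP; rewrite eqrXn2 // s2 => /eqP; lra.
have unitE c : unit_octonions R c -> osqnorm c = 1.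
  by rewrite -sqr_onorm => ->; rewrite expr1n.
(* With x = s c, the formula y = alpha^* x / |x|^2 becomes y = s^-1 alpha^* c. *)
apply: (homeomorphic_sets _ _ _ _ (fun v : 'cV[octonion R]_2 => s^-1 *: v 0 0)
  (fun c => col2 (s *: c) (s^-1 *: omul (oconj alpha) c))).
- move=> v; apply: (@continuous_comp _ _ _ (fun v : 'cV[octonion R]_2 => v 0 0)
    (fun x : octonion R => s^-1 *: x)).
    exact: mx_entry_continuous.
  exact: octonion_scale_continuous.
- apply: col2_continuous; first exact: octonion_scale_continuous.
  move=> c; apply: (@continuous_comp _ _ _ (omul (oconj alpha))
    (fun x : octonion R => s^-1 *: x)).
    exact: omul_continuous.
  exact: octonion_scale_continuous.
- move=> v /normE vE; rewrite /unit_octonions /= /onorm osqnormZ vE.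
  by rewrite -exprMn mulVf // expr1n sqrtr1.
- move=> c /unitE cE; apply/hopf_fiberP; rewrite !mxE /=; split.
    rewrite !osqnormZ osqnormM osqnorm_conj cE alphaE.
    by field.
  (* The scalars cancel, leaving c (c^* alpha) = |c|^2 alpha = alpha. *)
  rewrite oconjZ oconjM oconjK omulZl omulZr omul_mul_conj cE scalerA.
  by rewrite mulfV // !scale1r.
- move=> v vF; have vE := normE v vF.
  move: vF => /hopf_fiberP[_ alphaV]; rewrite [RHS]col2P; congr col2.
    by rewrite scalerA mulfV // scale1r.
  (* Here alpha^* = y x^*, so alpha^* x = |x|^2 y = s^2 y. *)
  rewrite omulZr -alphaV oconjM oconjK omul_conj_mul vE !scalerA.
  have -> : s^-1 * (s^-1 * s ^+ 2) = 1 by field.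
  by rewrite scale1r.
- by move=> c _; rewrite mxE /= scalerA mulVf // scale1r.
Qed.

Lemma hopf_fiber_homeo lambda alpha : (lambda, alpha) <> (0, 0) ->
  homeomorphic [set v | hopf v = traceless_hermitian_mx lambda alpha]
    (unit_octonions R).
Proof.
move=> nz; have [lambda_ge0|lambda_lt0] := leP 0 lambda.
  exact: hopf_fiber_homeo_ge0.
apply: homeomorphic_trans (hopf_fiber_swap lambda alpha) _.
apply: hopf_fiber_homeo_ge0; first by rewrite oppr_ge0 ltW.
by case=> /eqP; rewrite oppr_eq0 lt_eqF.
Qed.

(** Taking norms, the fiber equations give |x| = |y| and |x| |y| = 0. *)
Lemma hopf_fiber0 :
  [set v : 'cV[octonion R]_2 | hopf v = traceless_hermitian_mx 0 0] = [set 0].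
Proof.
have osqnorm0 : osqnorm (0 : octonion R) = 0.
  by rewrite -sqr_onorm (onorm_eq0 0).2 // expr0n.
apply/seteqP; split=> v /=; last first.
  move=> ->; apply/hopf_fiberP; rewrite !mxE subrr mulr0; split=> //.
  by apply: osqnorm_eq0; rewrite osqnormM osqnorm0 mul0r.
move=> /hopf_fiberP[]; rewrite mulr0 => /eqP; rewrite subr_eq0 => /eqP xy.
move=> /(congr1 (@osqnorm R)); rewrite osqnormM osqnorm_conj osqnorm0 xy.
move=> /eqP; rewrite mulf_eq0 orbb => /eqP y0; rewrite y0 in xy.
apply/matrixP => i j; rewrite mxE ord1.
by case/ord2P: i; exact: osqnorm_eq0.
Qed.

(** A self-conjugate diagonal entry has each imaginary coordinate equal to its opposite, hence is
    real; the trace and the Hermitian condition fix the second row. *)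
Lemma traceless_hermitianP (A : traceless_hermitian R) :
  exists lambda alpha, A = traceless_hermitian_mx lambda alpha.
Proof.
case: A => A AP; have [/matrixP AH At] := set_mem AP.
exists (A 0 0).1.1.1, (A 0 1); apply: val_inj => /=; rewrite [LHS]mx22P.
have A10 : A 1 0 = oconj (A 0 1) by rewrite -[LHS]AH !mxE.
have A00 : A 0 0 = oreal (A 0 0).1.1.1.
  have := AH 0 0; rewrite !mxE.
  case: (A 0 0) => [[[a b] [c d]] [[e f] [g h]]].
  rewrite /oconj /cd_conj /= => -[*].
  by rewrite /oreal; congr (_, _, (_, _), (_, _, (_, _))); lra.
have A11 : A 1 1 = - A 0 0.
  apply/eqP; rewrite -addr_eq0 addrC; apply/eqP.
  rewrite -[RHS]At /mxtrace big_ord_recl big_ord1.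
  by congr (_ + A _ _); exact: val_inj.
by rewrite -A00 A11 A10.
Qed.

End Fibers.

Theorem lemma15 (R : realType) :
  (forall A : traceless_hermitian R,
     exists v : 'cV[octonion R]_2, hopf v = A) /\
  (forall (lambda : R) (alpha : octonion R),
     ((lambda, alpha) <> (0, 0) ->
        homeomorphic [set v | hopf v = traceless_hermitian_mx lambda alpha]
                     (unit_octonions R)) /\
     ((lambda, alpha) = (0, 0) ->
        [set v : 'cV[octonion R]_2 | hopf v = traceless_hermitian_mx 0 0] = [set 0])).
Proof.
split; last first.
  move=> lambda alpha; split=> [|_]; first exact: hopf_fiber_homeo.
  exact: hopf_fiber0.
move=> A; have [lambda [alpha ->]] := traceless_hermitianP _ A.
(* Away from zero, the homeomorphism [g] from the unit octonions to the fiber sends 1 to a preimage;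
   over zero the preimage is 0. *)
have [[-> ->]|/hopf_fiber_homeo[_ [g _]]] := pselect ((lambda, alpha) = (0, 0)).
  by exists 0; have /seteqP[_] := hopf_fiber0 R; exact.
have onorm1 : unit_octonions R (oreal 1).
  rewrite /unit_octonions /= /onorm /osqnorm /cd_sqnorm /=.
  by rewrite expr0n expr1n !addr0 sqrtr1.
have v := g (exist _ (oreal 1) (mem_set onorm1)).
by exists (val v); exact: set_mem (valP v).
Qed.
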